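(* Let $g(x)=x\log x$ and let $f:U_s\times U_k\to\mathbb R$ be a continuous function such that (i) $\sup_{\boldsymbol y\in U_k}\|f(\cdot,\boldsymbol y)\|_{\mathcal W_{s,\boldsymbol\gamma_2}}\le C_{k,\boldsymbol\gamma_1}$ for some constant $C_{k,\boldsymbol\gamma_1}>0$; (ii) $g(I^{(2)}f)\in\mathcal W_{k,\boldsymbol\gamma_1}$ and $g(Q^{(2)}_\ell f)\in\mathcal W_{k,\boldsymbol\gamma_1}$ for all $\ell\ge0$. Let $\mathcal I:=\int_{U_k}g\big(\int_{U_s}f(\boldsymbol\theta,\boldsymbol y)\,{\rm d}\boldsymbol\theta\big)\,{\rm d}\boldsymbol y$. Suppose that the randomly shifted lattice rules $Q^{(1)}_\ell,Q^{(2)}_\ell$, $\ell\ge 0$, satisfy, with constants $C_1,C_2,\delta_1,\delta_2>0$ and for all $\ell\ge0$, $$ \|I^{(1)}F-Q^{(1)}_\ell F\|_{\boldsymbol\Delta}\le C_12^{-\delta_1\ell}\|F\|_{\mathcal W_{k,\boldsymbol\gamma_1}}\ \ (F\in\mathcal W_{k,\boldsymbol\gamma_1}),\qquad \|I^{(2)}F-Q^{(2)}_\ell F\|_{\boldsymbol\Delta}\le C_22^{-\delta_2\ell}\|F\|_{\mathcal W_{s,\boldsymbol\gamma_2}}\ \ (F\in\mathcal W_{s,\boldsymbol\gamma_2}). $$ Then for every $0<\alpha<1$ there is a constant $\tilde C_2>0$, independent of $\ell_1,\ell_2$, such that for all $\ell_1,\ell_2\ge0$ $$ \|\mathcal I-Q^{(1)}_{\ell_1}g(Q^{(2)}_{\ell_2}f)\|_{\boldsymbol\Delta}\le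 C_12^{-\delta_1\ell_1}\|g(I^{(2)}f)\|_{\mathcal W_{k,\boldsymbol\gamma_1}}+\tilde C_22^{-\alpha\delta_2\ell_2}\sup_{\boldsymbol y\in U_k}\|f(\cdot,\boldsymbol y)\|_{\mathcal W_{s,\boldsymbol\gamma_2}}. $$ In particular, for $\ell_1=\ell_2=\ell$ there is a constant $C'>0$ independent of $\ell$ such that $$ \|\mathcal I-Q^{(1)}_{\ell}g(Q^{(2)}_{\ell}f)\|_{\boldsymbol\Delta}\le C'\,2^{-\frac{\min\{\delta_1,\alpha\delta_2\}}{2}\ell}. $$
   Context: $U_m=[0,1]^m$; $s,k\in\mathbb N$. For positive weights $\boldsymbol\gamma=(\gamma_{\mathfrak u})_{\mathfrak u\subseteq\{1,\dots,m\}}$, $\mathcal W_{m,\boldsymbol\gamma}$ is the unanchored weighted Sobolev space of absolutely continuous functions $F:U_m\to\mathbb R$ with square-integrable first order mixed partial derivatives, with norm $$\|F\|_{\mathcal W_{m,\boldsymbol\gamma}}^2=\sum_{\mathfrak u\subseteq\{1,\dots,m\}}\frac1{\gamma_{\mathfrak u}}\int_{U_{|\mathfrak u|}}\Big(\int_{U_{m-|\mathfrak u|}}\partial_{\mathfrak u}F(\boldsymbol y)\,{\rm d}\boldsymbol y_{-\mathfrak u}\Big)^2{\rm d}\boldsymbol y_{\mathfrak u},$$ where $\partial_{\mathfrak u}=\partial^{|\mathfrak u|}/\prod_{j\in\mathfrak u}\partial y_j$, and ${\rm d}\boldsymbol y_{\mathfrak u}$, ${\rm d}\boldsymbol y_{-\mathfrak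 u}$ denote integration over the variables with index in, resp. not in, $\mathfrak u$. Fixed positive weights: $\boldsymbol\gamma_1=(\gamma_{1,\mathfrak u})_{\mathfrak u\subseteq\{1,\dots,k\}}$, $\boldsymbol\gamma_2=(\gamma_{2,\mathfrak u})_{\mathfrak u\subseteq\{1,\dots,s\}}$. $I^{(1)}F=\int_{U_k}F(\boldsymbol y)\,{\rm d}\boldsymbol y$ and $I^{(2)}F=\int_{U_s}F(\boldsymbol\theta)\,{\rm d}\boldsymbol\theta$. $Q^{(1)}_\ell F=2^{-\ell}\sum_{i=1}^{2^\ell}F(\boldsymbol y^{(\ell)}_i)$ with $\boldsymbol y_i^{(\ell)}=\{i\boldsymbol z/2^\ell+\boldsymbol\Delta\}$ (componentwise fractional part), $\boldsymbol z$ an integer generating vector and $\boldsymbol\Delta\sim\mathcal U([0,1]^k)$ a single random shift; $Q^{(2)}_\ell F=2^{-\ell}\sum_{i=1}^{2^\ell}F(\boldsymbol\theta_i^{(\ell)})$ with $s$-dimensional randomly shifted lattice points $\boldsymbol\theta_i^{(\ell)}$ defined analogously with an independent uniform random shift in $[0,1]^s$. Applied to $f(\boldsymbol\theta,\boldsymbol y)$, $I^{(2)}$ and $Q^{(2)}_\ell$ act on the variable $\boldsymbol\theta$ for each fixed $\boldsymbol y$, giving functions of $\boldsymbol y$. $\|X\|_{\boldsymbol\Delta}:=\sqrt{\mathbb E_{\boldsymbol\Delta}[|X|^2]}$, the expectation being over the random shifts. Convention: $0\log0=0$. *)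

(* Defs.v *)
From HB Require Import structures.
From mathcomp Require Export all_boot all_order all_algebra.
From mathcomp Require Export all_classical all_reals all_analysis.
Export Order.TTheory GRing.Theory Num.Theory.
Export numFieldNormedType.Exports.

Set Implicit Arguments.
Unset Strict Implicit.
Unset Printing Implicit Defensive.

Local Open Scope classical_set_scope.
Local Open Scope ring_scope.

Section cube.
Variable R : realType.

Definition ucube (m : nat) : set 'rV[R]_m :=
  [set y | forall j, 0 <= y 0 j <= 1].

(* The library's measures on the line live on measurableTypeR R, an alias of R
   with the same sigma-algebra. *)
Definition tcons (m : nat) (p : measurableTypeR R * m.-tuple R) :
    m.+1.-tuple R := [the m.+1.-tuple R of (p.1 : R) :: p.2].

Lemma measurable_tcons m :
  measurable_fun [set: measurableTypeR R * m.-tuple R] (@tcons m).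
Proof.
apply: (measurable_cons (f := fun p : measurableTypeR R * m.-tuple R => p.1 : R)).
  by move=> mD Y mY; exact: (@measurable_fst _ _ (measurableTypeR R) _).
exact: measurable_snd.
Qed.

HB.instance Definition _ m :=
  isMeasurableFun.Build _ _ _ _ (@tcons m) (@measurable_tcons m).

(* The library has product measures of pairs only, and a sigma-algebra on
   tuples but none on row vectors. So Lebesgue measure on [0,1]^m, which is
   also the uniform distribution there, is the m-fold product of the uniform
   distribution on [0,1], carried by m-tuples. *)
Fixpoint cube_prob (m : nat) : probability (m.-tuple R) R :=
  match m with
  | 0 => dirac [tuple]
  | m'.+1 =>
      distribution (uniform_prob (@ltr01 R) \x cube_prob m')%E (@tcons m')
  end.

Definition row_of (m : nat) (t : m.-tuple R) : 'rV[R]_m := \row_j tnth t j.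

Definition cube_int (m : nat) (F : 'rV[R]_m -> R) : R :=
  \int[cube_prob m]_(t in [set t | ucube (row_of t)]) F (row_of t).

End cube.

Arguments ucube {R} m.
Arguments cube_prob R m : clear implicits.

Section sobolev.
Variables (R : realType) (m : nat).
Implicit Types (F : 'rV[R]_m -> R) (u w : {set 'I_m}) (a b c : 'rV[R]_m).

(* The point with coordinates c outside u and, inside u, b on w and a off w. *)
Definition corner u w a b c : 'rV[R]_m :=
  \row_j if j \in u then (if j \in w then b 0 j else a 0 j) else c 0 j.

Definition increment F u a b c : R :=
  \sum_(w : {set 'I_m} | w \subset u)
    (-1) ^+ #|u :\: w| * F (corner u w a b c).

Definition face_vol u a b : R := \prod_(j in u) (b 0 j - a 0 j).

Definition nonoverlapping u a b a' b' : Prop :=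
  exists2 j, j \in u & b 0 j <= a' 0 j \/ b' 0 j <= a 0 j.

(* Absolute continuity of a function of several variables, in the sense of
   Caratheodory: on every section of [0,1]^m in the directions u, the interval
   function of the u-increments of F is absolutely continuous. For m = 1 this
   is the usual definition. *)
Definition abs_cont F : Prop :=
  forall u c, u != finset.set0 -> ucube m c -> forall e : R, 0 < e ->
  exists2 d : R, 0 < d &
  forall (n : nat) (a b : 'I_n -> 'rV[R]_m),
    (forall i, [/\ ucube m (a i), ucube m (b i)
                 & forall j, a i 0 j <= b i 0 j]) ->
    (forall i i', i != i' -> nonoverlapping u (a i) (b i) (a i') (b i')) ->
    \sum_(i < n) face_vol u (a i) (b i) < d ->
    \sum_(i < n) `|increment F u (a i) (b i) c| < e.

Definition mixed_deriv u F : 'rV[R]_m -> R :=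
  foldr (fun j (G : 'rV[R]_m -> R) y => 'D_(delta_mx 0 j) G y) F (enum u).

(* The iterated derivatives of an absolutely continuous F exist only almost
   everywhere, so square integrability is that of a measurable version. *)
Definition sobolev F : Prop :=
  abs_cont F /\
  forall u, exists2 G : m.-tuple R -> R, G \in Lfun (cube_prob R m) 2%:E &
    {ae cube_prob R m, forall t, mixed_deriv u F (row_of t) = G t}.

(* The point whose coordinates in u, resp. outside u, are those of yu,
   resp. yc, in increasing order. *)
Definition glue u (yu : 'rV[R]_#|u|) (yc : 'rV[R]_#|~: u|) : 'rV[R]_m :=
  \sum_(i < #|u|) yu 0 i *: delta_mx 0 (enum_val i) +
  \sum_(i < #|~: u|) yc 0 i *: delta_mx 0 (enum_val i).

Definition sobolev_norm (gamma : {set 'I_m} -> R) F : R :=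
  Num.sqrt (\sum_(u : {set 'I_m}) (gamma u)^-1 *
    cube_int (fun yu : 'rV[R]_#|u| =>
      (cube_int (fun yc : 'rV[R]_#|~: u| =>
         mixed_deriv u F (glue yu yc))) ^+ 2)).

End sobolev.

Section lattice.
Variables (R : realType) (m : nat).

Definition frac (x : R) : R := x - (Num.floor x)%:~R.

Definition lattice_point (l : nat) (z : 'rV[int]_m) (D : 'rV[R]_m) (i : nat) :
    'rV[R]_m :=
  \row_j frac (i%:R * (z 0 j)%:~R / 2 ^+ l + D 0 j).

Definition lattice_rule (l : nat) (z : 'rV[int]_m) (D : 'rV[R]_m)
    (F : 'rV[R]_m -> R) : R :=
  2 ^- l * \sum_(1 <= i < (2 ^ l).+1) F (lattice_point l z D i).

(* Root mean square error over a shift uniform on [0,1]^m. *)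
Definition lattice_rmse (l : nat) (z : 'rV[int]_m) (F : 'rV[R]_m -> R) :
    \bar R :=
  'N[cube_prob R m]_2%:E
    [(fun D => (cube_int F - lattice_rule l z (row_of D) F)%:E)]%E.

End lattice.

(* ln vanishes on nonpositive numbers: xlogx 0 = 0, and xlogx x = 0 for x < 0,
   where x log x is undefined. *)
Definition xlogx (R : realType) (x : R) : R := x * ln x.

(* Main.v *)
(** Write [g x = x log x].  Then
      I - Q1 g(Q2 f) = (I1 - Q1) g(I2 f) + Q1 (g(I2 f) - g(Q2 f)).
    The first term is the error of [Q1] on [g(I2 f)].  For the second, [f] is
    bounded by some [M] on the cube, and [g] is Hoelder of every order
    [alpha < 1] on [[-M, M]], so for each fixed [y] the second moment of
    [g(I2 f) - g(Q2 f)] over the inner shift is at most a constant times the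
    [alpha]-th power of the second moment of [I2 f - Q2 f].  This is uniform in
    [y], hence survives the average [Q1] (convexity of the square) and the
    integration over the outer shift (Tonelli). *)
Require Import Defs.
From mathcomp Require Import measurable_realfun ring lra.
Set Implicit Arguments.
Unset Strict Implicit.
Unset Printing Implicit Defensive.

Local Open Scope classical_set_scope.
Local Open Scope ring_scope.

(** * Measurability and boundedness of continuous functions on the cube *)

(** The preimage of [Y] is the countable union of the fibres of [q] over those [i] with [g i] in
    [Y]. So [g] may be any function of integer indices, which serves for [Num.floor] and for the
    grids. *)
Lemma measurable_fun_countable_factor d d' (T : measurableType d)
    (U : measurableType d') (I : countType) (q : T -> I) (g : I -> U) :
  (forall i, measurable (q @^-1` [set i])) ->
  measurable_fun [set: T] (g \o q).
Proof.
move=> mq _ Y _; rewrite setTI.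
rewrite (_ : _ @^-1` Y = \bigcup_i (if `[< Y (g i) >] then q @^-1` [set i]
                                    else set0)).
  apply: countable_bigcupT_measurable => // i.
  by case: ifP => _; [exact: mq|exact: measurable0].
apply/seteqP; split=> [t Yt|t [i _]] /=.
  by exists (q t) => //; rewrite asboolT.
by case: asboolP => [Yi /= ->|].
Qed.

Lemma measurable_floor_eq d (T : measurableType d) (R : realType) (h : T -> R)
    (n : int) :
  measurable_fun [set: T] h -> measurable [set t | Num.floor (h t) = n].
Proof.
move=> mh; rewrite (_ : mkset _ = h @^-1` `[n%:~R, (n + 1)%:~R[%classic).
  by rewrite -[X in measurable X]setTI; apply: mh.
apply/seteqP; split=> t; rewrite /= in_itv/=; last exact: floor_def.
by move=> <-; exact: floor_itv.
Qed.

Lemma measurable_frac (R : realType) : measurable_fun [set: R] (@frac R).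
Proof.
apply: measurable_funB => //.
have := @measurable_fun_countable_factor _ _ R R int (@Num.floor R)
  (fun z => z%:~R); apply => n.
exact: (@measurable_floor_eq _ _ _ id).
Qed.

Lemma frac_bounds (R : realType) (x : R) : 0 <= frac x <= 1.
Proof.
rewrite /frac subr_ge0 floor_le/= lerBlDl ltW//.
by have := floorD1_gt x; rewrite intrD.
Qed.

Lemma lattice_point_ucube (R : realType) m l z (D : 'rV[R]_m) i :
  ucube m (lattice_point l z D i).
Proof. by move=> j; rewrite mxE frac_bounds. Qed.

(* The sigma-algebra on tuples is generated by the coordinates and is not tied to
   the topology of row vectors: a continuous function of measurable coordinates
   is shown to be measurable as the limit of its values at nearby points of the
   grid of mesh [1 / (n + 1)], which take countably many values. *)
Definition grid_index (R : realType) (m n : nat) (y : 'rV[R]_m) : 'rV[int]_m :=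
  \row_j Num.floor (y 0 j * n.+1%:R).

Definition grid_node (R : realType) (m n : nat) (a : 'rV[int]_m) : 'rV[R]_m :=
  \row_j ((a 0 j)%:~R / n.+1%:R).

Definition grid (R : realType) (m n : nat) (y : 'rV[R]_m) : 'rV[R]_m :=
  grid_node R n (grid_index n y).

Lemma grid_ucube (R : realType) m n (y : 'rV[R]_m) :
  ucube m y -> ucube m (grid n y).
Proof.
move=> cy j; rewrite !mxE; have /andP[y0 y1] := cy j.
rewrite divr_ge0//=; last by rewrite ler0z floor_ge0 mulr_ge0.
by rewrite ler_pdivrMr// (le_trans (floor_le _))// ler_wpM2r.
Qed.

Lemma cvg_grid (R : realType) m (y : 'rV[R]_m) : grid n y @[n --> \oo] --> y.
Proof.
apply/cvg_ballP => e e0; near=> n.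
split=> // i j; rewrite ord1 /ball/= !mxE.
have n0 : (0 : R) < n.+1%:R by [].
have fl := floor_le (y 0 j * n.+1%:R).
have fg := floorD1_gt (y 0 j * n.+1%:R).
have /andP[l1 l2] : 0 <= y 0 j - (Num.floor (y 0 j * n.+1%:R))%:~R / n.+1%:R
    <= n.+1%:R^-1.
  rewrite subr_ge0 ler_pdivrMr// fl/= lerBlDl -[X in _ + X]mul1r -mulrDl.
  by rewrite ler_pdivlMr// ltW//; rewrite intrD in fg.
rewrite ger0_norm//; apply: le_lt_trans l2 _.
near: n; exact: near_infty_natSinv_lt (PosNum e0).
Unshelve. all: by end_near.
Qed.

Lemma measurable_grid_index_eq d (T : measurableType d) (R : realType) m n
    (phi : T -> 'rV[R]_m) a :
  (forall j, measurable_fun [set: T] (fun t => phi t 0 j)) ->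
  measurable [set t | grid_index n (phi t) = a].
Proof.
move=> mphi; rewrite (_ : mkset _ = \bigcap_(j in [set: 'I_m])
    [set t | Num.floor (phi t 0 j * n.+1%:R) = a 0 j]).
  apply: fin_bigcap_measurable => // j _.
  by apply: measurable_floor_eq; exact: measurable_funM.
apply/seteqP; split=> t /= => [<- j _|ta]; first by rewrite mxE.
by apply/rowP => j; rewrite mxE; exact: ta.
Qed.

Lemma measurable_continuous_ucube d (T : measurableType d) (R : realType) s k
    (f : 'rV[R]_s -> 'rV[R]_k -> R) (phi : T -> 'rV[R]_s) (psi : T -> 'rV[R]_k) :
  {within ucube s `*` ucube k,
     continuous (fun p : 'rV[R]_s * 'rV[R]_k => f p.1 p.2)} ->
  (forall t, ucube s (phi t)) -> (forall t, ucube k (psi t)) ->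
  (forall j, measurable_fun [set: T] (fun t => phi t 0 j)) ->
  (forall j, measurable_fun [set: T] (fun t => psi t 0 j)) ->
  measurable_fun [set: T] (fun t => f (phi t) (psi t)).
Proof.
move=> cf cphi cpsi mphi mpsi.
apply: (@measurable_fun_cvg _ _ _ _
  (fun n t => f (grid n (phi t)) (grid n (psi t)))) => [n|t _].
  pose q t := (grid_index n (phi t), grid_index n (psi t)).
  apply: (@measurable_fun_countable_factor _ _ _ _
    ('rV[int]_s * 'rV[int]_k)%type q
    (fun a => f (grid_node R n a.1) (grid_node R n a.2))) => -[a b].
  rewrite (_ : _ @^-1` _ = [set t | grid_index n (phi t) = a] `&`
                           [set t | grid_index n (psi t) = b]).
    by apply: measurableI; exact: measurable_grid_index_eq.
  by apply/seteqP; split=> t /=; [case=> -> ->|case=> <- <-].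
have /subspace_continuousP/(_ (phi t, psi t) (conj (cphi t) (cpsi t))) cft := cf.
have cg : (grid n (phi t), grid n (psi t)) @[n --> \oo] --> (phi t, psi t).
  have c1 := @cvg_grid R s (phi t); have c2 := @cvg_grid R k (psi t).
  by apply: (cvg_pair c1 c2).
(* [f] is continuous only relative to the cubes, so the grid points must converge inside them;
   rounding down keeps them there. *)
suff cw : (grid n (phi t), grid n (psi t)) @[n --> \oo] -->
    within (ucube s `*` ucube k) (nbhs (phi t, psi t)) by exact: cvg_comp cw cft.
move=> A /cg; apply: (@filterS nat \oo _ _ _) => n /=; apply.
by split; exact: grid_ucube.
Qed.

(** Tonelli's theorem settles nonnegative functions; it is applied to the positive and the negative
    part of [h]. *)
Lemma measurable_integral_section d1 d2 (T1 : measurableType d1)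
    (T2 : measurableType d2) (R : realType)
    (mu : {sigma_finite_measure set T2 -> \bar R}) (h : T1 * T2 -> \bar R) :
  measurable_fun [set: T1 * T2] h ->
  measurable_fun [set: T1] (fun x => (\int[mu]_y h (x, y))%E).
Proof.
move=> mh.
rewrite (_ : (fun x => _) = fubini_F mu h^\+%E \- fubini_F mu h^\-%E)%E.
  apply: emeasurable_funB; apply: measurable_fun_fubini_tonelli_F => //.
    exact: measurable_funepos.
  exact: measurable_funeneg.
by apply/funext => x; rewrite integralE /fubini_F !unlock.
Qed.

Lemma continuous_ucube_bounded (R : realType) s k (f : 'rV[R]_s -> 'rV[R]_k -> R) :
  {within ucube s `*` ucube k,
     continuous (fun p : 'rV[R]_s * 'rV[R]_k => f p.1 p.2)} ->
  exists2 M : R, 0 < M &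
    forall x y, ucube s x -> ucube k y -> `|f x y| <= M.
Proof.
move=> cf.
have cu m : compact (@ucube R m).
  rewrite (_ : ucube m = [set v : 'rV[R]_m | forall j, `[0, 1]%classic (v 0 j)]).
    exact: rV_compact (fun=> @segment_compact _ _ _).
  by apply/seteqP; split=> v vu j; have := vu j; rewrite /= in_itv.
have /compact_bounded[N [_ fN]] :=
  continuous_compact cf (compact_setX (cu s) (cu k)).
(* Every number above [N] is a bound; this one is also positive. *)
exists (`|N| + 1); first by rewrite ltr_wpDl.
move=> x y xu yu; apply: (fN (`|N| + 1)) => /=; last by exists (x, y).
by rewrite ltr_pwDr// ler_norm.
Qed.

(** * Hoelder continuity of [x log x] on bounded intervals *)

Lemma powR_lin (R : realType) (b x : R) : 0 <= b <= 1 -> 0 <= x ->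
  x `^ b <= 1 + x.
Proof.
move=> /andP[b0 b1] x0; have [x1|/ltW x1] := leP 1 x.
  by rewrite (le_trans (ler1_powR _ _))// lerDr.
rewrite (@le_trans _ _ 1) ?lerDl//.
by have := @ge0_ler_powR R b b0 x 1; rewrite powR1 !nnegrE; exact.
Qed.

(** For [x >= 1] the second term suffices, by [ln x < x]. For [x <= 1] the first does, by the same
    inequality at [x ^ (- b)], whose logarithm is [- b * ln x]. *)
Lemma ln_norm_le (R : realType) (b x : R) : 0 < b -> 0 < x ->
  `|ln x| <= b^-1 * x `^ (- b) + x.
Proof.
move=> b0 x0; have [x1|/ltW x1] := leP 1 x.
  rewrite ger0_norm ?ln_ge0// (le_trans (ltW (ln_sublinear x0)))//.
  by rewrite lerDr mulr_ge0 ?invr_ge0 ?powR_ge0// ltW.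
rewrite ler0_norm ?ln_le0// (@le_trans _ _ (b^-1 * x `^ (- b))) ?lerDl ?(ltW x0)//.
have := ltW (ln_sublinear (powR_gt0 (- b) x0)).
by rewrite ln_powR mulNr -mulrN -ler_pdivlMl//; exact.
Qed.

(** The increment is [(y - x) * ln y + x * ln (y / x)], and the last term is at most [y - x] by
    [ln (1 + t) <= t] with [t = (y - x) / x]. *)
Lemma xlogx_increment_log (R : realType) (x y : R) : 0 <= x <= y -> 0 < y ->
  `|xlogx y - xlogx x| <= (y - x) * (`|ln y| + 1).
Proof.
move=> /andP[x0 xy] y0; have h0 : 0 <= y - x by rewrite subr_ge0.
have [->|xn0] := eqVneq x 0.
  rewrite /xlogx mul0r !subr0 normrM gtr0_norm// ler_wpM2l ?lerDl//.
  exact: ltW.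
have {xn0}x0 : 0 < x by rewrite lt_neqAle eq_sym xn0.
have -> : xlogx y - xlogx x = (y - x) * ln y + x * (ln y - ln x).
  by rewrite /xlogx mulrBl mulrBr addrA subrK.
rewrite (le_trans (ler_normD _ _))// [leRHS]mulrDr mulr1 normrM (ger0_norm h0) lerD2l.
rewrite -ln_div ?posrE// normrM (gtr0_norm x0).
rewrite ger0_norm; last by rewrite ln_ge0// ler_pdivlMr// mul1r.
rewrite mulrC -ler_pdivlMr//.
have -> : y / x = 1 + (y - x) / x by rewrite mulrBl divff ?gt_eqF// addrC subrK.
by rewrite le_ln1Dx// (@lt_le_trans _ _ 0) ?ltrN10// divr_ge0// ltW.
Qed.

(** The factor [y - x] absorbs the singularity of the logarithm: as [y - x <= y], the term
    [y ^ (- b)] is at most [(y - x) ^ (- b)]. What remains is linear in [y - x] and becomes a power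
    through [(y - x) ^ b <= 1 + M]. *)
Lemma xlogx_increment_powR (R : realType) (b M x y : R) : 0 < b <= 1 ->
  0 <= x <= y -> y <= M ->
  `|xlogx y - xlogx x| <= (b^-1 + (M + 1) * (1 + M)) * (y - x) `^ (1 - b).
Proof.
move=> /andP[b0 b1] /andP[x0 xy] yM.
have M0 : 0 <= M by rewrite (le_trans x0)// (le_trans xy).
have K0 : 0 <= b^-1 + (M + 1) * (1 + M).
  by rewrite addr_ge0 ?invr_ge0 ?mulr_ge0 ?addr_ge0// ltW.
have [xyE|neq] := eqVneq x y.
  by rewrite xyE subrr normr0 mulr_ge0// powR_ge0.
have {}xy : x < y by rewrite lt_neqAle neq.
have y0 : 0 < y by exact: le_lt_trans xy.
have h0 : 0 < y - x by rewrite subr_gt0.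
have hy : y - x <= y by rewrite gerBl.
rewrite (le_trans (xlogx_increment_log _ y0)) ?x0 ?(ltW xy)//.
have hb : (y - x) * (y - x) `^ (- b) = (y - x) `^ (1 - b).
  rewrite powRD ?powRr1// ?(ltW h0)//.
  by apply/implyP; rewrite (gt_eqF h0).
have h1 : y - x <= (1 + M) * (y - x) `^ (1 - b).
  rewrite -hb mulrCA -[leLHS]mulr1 ler_wpM2l ?(ltW h0)// powRN.
  rewrite ler_pdivlMr ?powR_gt0// mul1r.
  rewrite (le_trans (powR_lin _ (ltW h0))) ?(ltW b0)//.
  by rewrite lerD2l (le_trans hy).
rewrite (@le_trans _ _ ((y - x) * (b^-1 * (y - x) `^ (- b) + (M + 1))))//.
  rewrite ler_wpM2l ?(ltW h0)// addrA lerD2r.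
  rewrite (le_trans (ln_norm_le b0 y0))// lerD// ler_wpM2l ?invr_ge0 ?(ltW b0)//.
  rewrite !powRN lef_pV2 ?posrE ?powR_gt0//.
  by rewrite ge0_ler_powR ?nnegrE ?(ltW b0) ?(ltW h0) ?(ltW y0).
rewrite [leLHS]mulrDr mulrCA hb [leRHS]mulrDl lerD2l mulrC -mulrA.
by rewrite ler_wpM2l// addr_ge0.
Qed.

(* Both sides are 0 for [x < 0], as [ln] vanishes there. *)
Lemma xlogx_max0 (R : realType) (x : R) : xlogx (Num.max 0 x) = xlogx x.
Proof. by rewrite /xlogx; case: leP => // x0; rewrite (ln0 (ltW x0)) mulr0 mul0r. Qed.

(** Truncation at 0 preserves [xlogx] and does not increase distances, so the nonnegative case with
    [b = 1 - a] is enough. *)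
Lemma xlogx_hoelder (R : realType) (a M : R) : 0 < a < 1 -> 0 < M ->
  exists2 K : R, 0 < K & forall x y, `|x| <= M -> `|y| <= M ->
    `|xlogx x - xlogx y| <= K * `|x - y| `^ a.
Proof.
move=> /andP[a0 a1] M0.
have b01 : 0 < 1 - a <= 1 by rewrite subr_gt0 a1 gerBl ltW.
pose K := (1 - a)^-1 + (M + 1) * (1 + M).
have K0 : 0 < K.
  by rewrite ltr_pwDl ?invr_gt0 ?subr_gt0 ?mulr_ge0 ?addr_ge0 ?(ltW M0).
exists K => // x y.
wlog: x y / x <= y => [wl xM yM|xy].
  have [/wl|/ltW/wl] := leP x y; first exact.
  by rewrite distrC [`|x - y|]distrC; exact.
move=> /ler_normlW xM /ler_normlW yM.
rewrite -(xlogx_max0 x) -(xlogx_max0 y) [leLHS]distrC.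
have mxy : Num.max 0 x <= Num.max 0 y.
  by rewrite ge_max !le_max lexx xy orbT.
have m0 : 0 <= Num.max 0 x <= Num.max 0 y by rewrite mxy le_max lexx.
have mM : Num.max 0 y <= M by rewrite ge_max yM ltW.
apply: (le_trans (xlogx_increment_powR b01 m0 mM)).
rewrite -/K subKr ler_wpM2l ?(ltW K0)// distrC ger0_norm ?subr_ge0//.
rewrite ge0_ler_powR ?nnegrE ?subr_ge0 ?(ltW a0)//.
by rewrite /Num.max; case: (ltP 0 x) => ?; case: (ltP 0 y) => ?; lra.
Qed.

(** * L2 norms and second moments *)

(** Squaring and its inverse are monotone on [[0, +oo]]. The form of an equality between comparisons
    lets bounds be rewritten in both directions. *)
Lemma Lnorm2_le d (T : measurableType d) (R : realType)
    (mu : {measure set T -> \bar R}) (h : T -> R) (c : R) : 0 <= c ->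
  ('N[mu]_2%:E [EFin \o h] <= c%:E)%E =
  (\int[mu]_x (h x ^+ 2)%:E <= (c ^+ 2)%:E)%E.
Proof.
move=> c0.
have <- : ('N[mu]_2%:E [EFin \o h] `^ 2 = \int[mu]_x (h x ^+ 2)%:E)%E.
  rewrite poweR_Lnorm//; apply: eq_integral => x _ /=.
  by rewrite powR_mulrn// real_normK ?num_real.
have -> : (c ^+ 2)%:E = (c%:E `^ 2)%E by rewrite poweR_EFin powR_mulrn.
have mem (x : \bar R) : (0 <= x)%E -> x \in `[0%E, +oo%E].
  by move=> x0; rewrite in_itv/= x0 leey.
have sq (x : \bar R) : (0 <= x)%E -> x = ((x `^ 2) `^ 2^-1)%E.
  by move=> x0; rewrite -poweRrM mulfV// poweRe1.
apply/idP/idP => [le1|le2].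
  by apply: gt0_ler_poweR => //; apply: mem; [exact: Lnorm_ge0|rewrite lee_fin].
rewrite [leLHS]sq ?Lnorm_ge0// [leRHS]sq ?lee_fin//.
by apply: gt0_ler_poweR => //; apply: mem; exact: poweR_ge0.
Qed.

Lemma measurable_sqr d (T : measurableType d) (R : realType) (h : T -> R) :
  measurable_fun [set: T] h ->
  measurable_fun [set: T] (fun t => (h t ^+ 2)%:E).
Proof. by move=> mh; apply/measurable_EFinP; exact: measurable_funX. Qed.

Lemma integral_prob_cst d (T : measurableType d) (R : realType)
    (P : probability T R) (r : \bar R) : (\int[P]_t r = r)%E.
Proof.
rewrite (integral_cst P measurableT) -[RHS]mule1; congr (_ * _)%E.
exact: probability_setT.
Qed.

(* For [e > 0] and [t >= 0], [t ^ (2 a) <= e ^ (2 a) * (1 + (t / e) ^ 2)]; this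
   replaces Jensen's inequality [E (t ^ (2 a)) <= (E (t ^ 2)) ^ a]. *)
Lemma hoelder_second_moment d (T : measurableType d) (R : realType)
    (P : probability T R) (X h : T -> R) (a K e : R) :
  0 < a < 1 -> 0 <= K -> 0 < e ->
  measurable_fun [set: T] X -> measurable_fun [set: T] h ->
  (forall t, `|X t| <= K * `|h t| `^ a) ->
  (\int[P]_t (h t ^+ 2)%:E <= (e ^+ 2)%:E)%E ->
  (\int[P]_t (X t ^+ 2)%:E <= ((2 * K * e `^ a) ^+ 2)%:E)%E.
Proof.
move=> /andP[a0 a1] K0 e0 mX mh Xh hle.
pose c := (K * e `^ a) ^+ 2.
have c0 : 0 <= c by exact: sqr_ge0.
have ee0 : 0 <= e ^- 2 by rewrite invr_ge0 sqr_ge0.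
have mh2 := measurable_sqr mh.
have X2 t : X t ^+ 2 <= c * (1 + e ^- 2 * h t ^+ 2).
  have -> : X t ^+ 2 = `|X t| ^+ 2 by rewrite real_normK ?num_real.
  apply: (@le_trans _ _ ((K * `|h t| `^ a) ^+ 2)).
    by rewrite ler_sqr ?nnegrE ?mulr_ge0 ?powR_ge0.
  have -> : `|h t| = e * (`|h t| / e) by rewrite mulrC divfK ?gt_eqF.
  rewrite powRM ?divr_ge0 ?(ltW e0)// mulrA exprMn ler_wpM2l//.
  rewrite -[leLHS]powR_mulrn ?powR_ge0// powRAC powR_mulrn ?divr_ge0 ?(ltW e0)//.
  rewrite (le_trans (powR_lin _ _)) ?(ltW a0) ?(ltW a1) ?sqr_ge0// lerD2l.
  by rewrite exprMn real_normK ?num_real// mulrC exprVn.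
(* The mean of [1 + (h / e) ^ 2] is at most 2; the larger factor 4 makes the bound a perfect square,
   ready for [Lnorm2_le]. *)
have -> : ((2 * K * e `^ a) ^+ 2)%:E = (c%:E * 4%:E)%E.
  by rewrite -EFinM -mulrA exprMn mulrC; congr (_ * _)%:E; ring.
apply: (@le_trans _ _ (c%:E * (1 + (e ^- 2)%:E * \int[P]_t (h t ^+ 2)%:E))%E);
  last first.
  rewrite lee_wpmul2l ?lee_fin//.
  apply: (@le_trans _ _ (1 + (e ^- 2)%:E * (e ^+ 2)%:E)%E).
    by rewrite leeD2l// lee_wpmul2l ?lee_fin.
  by rewrite -EFinM -EFinD lee_fin mulVf ?expf_neq0 ?gt_eqF//; lra.
have <- : (\int[P]_t (c * (1 + e ^- 2 * h t ^+ 2))%:E =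
    c%:E * (1 + (e ^- 2)%:E * \int[P]_t (h t ^+ 2)%:E))%E.
  have mg : measurable_fun [set: T] (fun t => e ^- 2 * h t ^+ 2).
    by apply: measurable_funM => //; exact: measurable_funX.
  have mge := (measurable_EFinP _ _).2 mg.
  under eq_integral do rewrite EFinM.
  rewrite ge0_integralZl_EFin//; first last.
  - by apply/measurable_EFinP; exact: measurable_funD.
  - by move=> t _; rewrite lee_fin addr_ge0// mulr_ge0// sqr_ge0.
  congr (_ * _)%E; under eq_integral do rewrite EFinD.
  rewrite ge0_integralD//; last by move=> t _; rewrite lee_fin mulr_ge0// sqr_ge0.
  rewrite integral_prob_cst; congr (_ + _)%E.
  under eq_integral do rewrite EFinM.
  by rewrite ge0_integralZl_EFin// => t _; rewrite lee_fin sqr_ge0.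
apply: ge0_le_integral => //.
- by move=> t _; rewrite lee_fin sqr_ge0.
- exact: measurable_sqr.
- apply/measurable_EFinP/measurable_funM => //; apply: measurable_funD => //.
  by apply: measurable_funM => //; exact: measurable_funX.
- by move=> t _; rewrite lee_fin.
Qed.

(** * Lattice rules as averages with equal weights *)

Section lattice_rule_theory.
Variables (R : realType) (m l : nat) (z : 'rV[int]_m) (D : 'rV[R]_m).
Implicit Types F G : 'rV[R]_m -> R.

Lemma lattice_ruleB F G :
  lattice_rule l z D (fun y => F y - G y) =
  lattice_rule l z D F - lattice_rule l z D G.
Proof. by rewrite /lattice_rule sumrB mulrBr. Qed.

Lemma lattice_rule_norm_le F (M : R) :
  (forall y, ucube m y -> `|F y| <= M) -> `|lattice_rule l z D F| <= M.
Proof.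
move=> FM; rewrite normrM normfV normrX normr_nat ler_pdivrMl ?exprn_gt0//.
rewrite (le_trans (ler_norm_sum _ _ _))//.
rewrite (le_trans (ler_sum _ (G := fun=> M) _))//.
  by move=> i _; apply: FM; exact: lattice_point_ucube.
by rewrite sumr_const_nat subn1/= -[leLHS]mulr_natl natrX.
Qed.

(** Nonnegativity of the variance: expand the average of [(F - a) ^ 2], where [a] is the average of
    [F]. *)
Lemma lattice_rule_sqr_le F :
  lattice_rule l z D F ^+ 2 <= lattice_rule l z D (fun y => F y ^+ 2).
Proof.
set a := lattice_rule l z D F.
have p0 : (2 : R) ^+ l != 0 by rewrite expf_neq0.
have cst_sum (b : R) : 2 ^- l * (\sum_(1 <= i < (2 ^ l).+1) b) = b.
  by rewrite sumr_const_nat subn1/= -[X in _ * X]mulr_natl natrX mulKf.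
have : 0 <= lattice_rule l z D (fun y => (F y - a) ^+ 2).
  rewrite mulr_ge0 ?invr_ge0 ?exprn_ge0// sumr_ge0// => i _; exact: sqr_ge0.
have -> : lattice_rule l z D (fun y => (F y - a) ^+ 2) =
    lattice_rule l z D (fun y => F y ^+ 2) - 2 * a * a + a ^+ 2.
  have cS : 2 ^- l * (\sum_(1 <= i < (2 ^ l).+1) F (lattice_point l z D i)) = a.
    by [].
  have eqi i : (F (lattice_point l z D i) - a) ^+ 2 =
      F (lattice_point l z D i) ^+ 2 - 2 * a * F (lattice_point l z D i) + a ^+ 2.
    ring.
  rewrite /lattice_rule (eq_bigr _ (fun i _ => eqi i)) big_split sumrB/=.
  by rewrite -mulr_sumr mulrDr mulrBr cst_sum [in X in _ - X]mulrCA cS.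
lra.
Qed.

End lattice_rule_theory.

(** * Measurability and moments of the rules and of the inner integral *)

Lemma measurable_row_of (R : realType) m (j : 'I_m) :
  measurable_fun [set: m.-tuple R] (fun t => row_of t 0 j).
Proof. by under eq_fun do rewrite mxE; exact: measurable_tnth. Qed.

Lemma measurable_lattice_point d (T : measurableType d) (R : realType) m l z i
    (D : T -> 'rV[R]_m) (j : 'I_m) :
  measurable_fun [set: T] (fun t => D t 0 j) ->
  measurable_fun [set: T] (fun t => lattice_point l z (D t) i 0 j).
Proof.
move=> mD; under eq_fun do rewrite mxE.
by apply: measurableT_comp; [exact: measurable_frac|exact: measurable_funD].
Qed.

Lemma measurable_row_ucube (R : realType) m :
  measurable [set t : m.-tuple R | ucube m (row_of t)].
Proof.
rewrite (_ : mkset _ = \bigcap_(j in [set: 'I_m])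
    (fun t : m.-tuple R => row_of t 0 j) @^-1` `[0, 1]%classic).
  apply: fin_bigcap_measurable => // j _.
  rewrite -[X in measurable X]setTI; apply: measurable_row_of => //.
by apply/seteqP; split=> t ct j => [_|]; have := ct j;
  rewrite /= in_itv/= => ctj //; exact: ctj.
Qed.

(* Turns the integral over the cube into one over all tuples, of an integrand
   evaluated at points of the cube only. *)
Definition clamp (R : realType) m (y : 'rV[R]_m) : 'rV[R]_m :=
  \row_j Num.max 0 (Num.min 1 (y 0 j)).

Lemma clamp_ucube (R : realType) m (y : 'rV[R]_m) : ucube m (clamp y).
Proof. by move=> j; rewrite mxE le_max lexx/= ge_max ler01 ge_min lexx. Qed.

Lemma clamp_id (R : realType) m (y : 'rV[R]_m) : ucube m y -> clamp y = y.
Proof.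
move=> cy; apply/rowP => j; rewrite mxE; have /andP[y0 y1] := cy j.
by rewrite (min_idPr y1) (max_idPr y0).
Qed.

Lemma measurable_clamp d (T : measurableType d) (R : realType) m
    (D : T -> 'rV[R]_m) (j : 'I_m) :
  measurable_fun [set: T] (fun t => D t 0 j) ->
  measurable_fun [set: T] (fun t => clamp (D t) 0 j).
Proof.
move=> mD; under eq_fun do rewrite mxE.
by apply: measurable_maxr => //; exact: measurable_minr.
Qed.

Section continuous_kernel.
Variables (R : realType) (s k : nat) (f : 'rV[R]_s -> 'rV[R]_k -> R).
Hypothesis f_cont : {within ucube s `*` ucube k,
  continuous (fun p : 'rV[R]_s * 'rV[R]_k => f p.1 p.2)}.

Lemma measurable_lattice_rule d (T : measurableType d) l z
    (D : T -> 'rV[R]_s) (psi : T -> 'rV[R]_k) :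
  (forall j, measurable_fun [set: T] (fun t => D t 0 j)) ->
  (forall t, ucube k (psi t)) ->
  (forall j, measurable_fun [set: T] (fun t => psi t 0 j)) ->
  measurable_fun [set: T] (fun t => lattice_rule l z (D t) (f ^~ (psi t))).
Proof.
move=> mD cpsi mpsi; apply: measurable_funM => //; apply: measurable_sum => i.
apply: measurable_continuous_ucube => // [t|j]; first exact: lattice_point_ucube.
exact: measurable_lattice_point.
Qed.

(** Apply [measurable_integral_section] to the jointly measurable [h]; the real integral is [fine]
    of the extended one. *)
Lemma measurable_cube_int d (T : measurableType d) (psi : T -> 'rV[R]_k) :
  (forall t, ucube k (psi t)) ->
  (forall j, measurable_fun [set: T] (fun t => psi t 0 j)) ->
  measurable_fun [set: T] (fun t => cube_int (f ^~ (psi t))).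
Proof.
move=> cpsi mpsi; pose S := [set x : s.-tuple R | ucube s (row_of x)].
have mS : measurable S by exact: measurable_row_ucube.
pose h (p : T * s.-tuple R) : \bar R :=
  (f (clamp (row_of p.2)) (psi p.1) * \1_S p.2)%:E.
have mh : measurable_fun [set: T * s.-tuple R] h.
  apply/measurable_EFinP/measurable_funM.
    apply: measurable_continuous_ucube => // [t|j|j]; first exact: clamp_ucube.
      apply: measurable_clamp.
      by apply: (measurableT_comp (@measurable_row_of R s j)).
    by apply: (measurableT_comp (mpsi j)).
  by apply: (measurableT_comp (measurable_indic mS)).
rewrite (_ : (fun t => _) =
    fine \o (fun t => \int[cube_prob R s]_x h (t, x))%E).
  apply: measurableT_comp; first exact: fine_measurable.
  exact: measurable_integral_section.
apply/funext => t; rewrite /cube_int /Rintegral integral_mkcond/=.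
congr fine; apply: eq_integral => x _; rewrite /h patchE/= indicE.
case: ifPn => [xS|_]; last by rewrite mulr0.
by rewrite mulr1 clamp_id//; exact: set_mem xS.
Qed.

Lemma cube_int_norm_le (M : R) (y : 'rV[R]_k) : ucube k y ->
  (forall x, ucube s x -> `|f x y| <= M) -> `|cube_int (f ^~ y)| <= M.
Proof.
move=> cy fM; pose S := [set x : s.-tuple R | ucube s (row_of x)].
have mS : measurable S by exact: measurable_row_ucube.
(* Evaluation at the origin gives the sign, used at the end where the mass of [S] is bounded by
   1. *)
have M0 : 0 <= M.
  rewrite (le_trans _ (fM 0 _))// => j; by rewrite mxE lexx ler01.
have Sfin : (cube_prob R s S < +oo)%E.
  by rewrite (le_lt_trans (probability_le1 _ _))// ltry.
have mf : measurable_fun S (fun x : s.-tuple R => f (row_of x) y).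
  have mcl : measurable_fun [set: s.-tuple R]
      (fun x => f (clamp (row_of x)) y).
    apply: measurable_continuous_ucube => // [t|j]; first exact: clamp_ucube.
    by apply: measurable_clamp; exact: measurable_row_of.
  apply: (eq_measurable_fun _ _ (measurable_funTS mcl)) => x /set_mem xS /=.
  by rewrite clamp_id.
have int : (cube_prob R s).-integrable S (EFin \o (fun x => f (row_of x) y)).
  apply: measurable_bounded_integrable => //.
  exists M; split; first exact: num_real.
  by move=> N MN x xS /=; rewrite (le_trans (fM _ xS))// ltW.
rewrite /cube_int (le_trans (le_normr_Rintegral mS int))//.
apply: (@le_trans _ _ (\int[cube_prob R s]_(x in S) M)).
  apply: le_Rintegral => //.
  - exact: (integrable_norm int).
  - exact: finite_measure_integrable_cst.
  - by move=> x xS; exact: fM.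
rewrite Rintegral_cst// -[leRHS]mulr1 ler_wpM2l// -lee_fin fineK.
  exact: probability_le1.
by rewrite ge0_fin_numE.
Qed.

End continuous_kernel.

(** For each [t], the square of the average is at most the average of the squares; each of the
    [2 ^ l] squares then integrates to at most [c]. The bound is the same for every shift [D], as
    the later integration over the outer shift requires. *)
Lemma lattice_rule_second_moment d (T : measurableType d) (R : realType)
    (mu : {measure set T -> \bar R}) m l z (D : 'rV[R]_m)
    (X : 'rV[R]_m -> T -> R) (c : R) :
  (forall y, ucube m y -> measurable_fun [set: T] (X y)) ->
  (forall y, ucube m y -> (\int[mu]_t (X y t ^+ 2)%:E <= c%:E)%E) ->
  (\int[mu]_t (lattice_rule l z D (X ^~ t) ^+ 2)%:E <= c%:E)%E.
Proof.
move=> mX Xc.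
have mXi i : measurable_fun [set: T] (X (lattice_point l z D i)).
  by apply: mX; exact: lattice_point_ucube.
apply: (@le_trans _ _ (\int[mu]_t
    (lattice_rule l z D (fun y => X y t ^+ 2))%:E)%E).
  apply: ge0_le_integral => //.
  - by move=> t _; rewrite lee_fin sqr_ge0.
  - apply: measurable_sqr; apply: measurable_funM => //.
    exact: measurable_sum.
  - apply/measurable_EFinP/measurable_funM => //.
    by apply: measurable_sum => i; exact: measurable_funX.
  - by move=> t _; rewrite lee_fin lattice_rule_sqr_le.
under eq_integral do rewrite EFinM -sumEFin.
have i2 : 0 <= (2 : R) ^- l by rewrite invr_ge0 exprn_ge0.
rewrite ge0_integralZl_EFin//; first last.
- by apply: emeasurable_sum => i; exact: measurable_sqr.
- by move=> t _; rewrite sume_ge0// => i _; rewrite lee_fin sqr_ge0.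
rewrite ge0_integral_sum//; first last.
- by move=> i t _; rewrite lee_fin sqr_ge0.
- by move=> i; exact: measurable_sqr.
apply: (@le_trans _ _ ((2 ^- l)%:E * \sum_(1 <= i < (2 ^ l).+1) c%:E)%E).
  rewrite lee_wpmul2l ?lee_fin//; apply: lee_sum => i _; apply: Xc.
  exact: lattice_point_ucube.
rewrite sumEFin -EFinM lee_fin sumr_const_nat subn1/= -[X in _ * X]mulr_natl.
by rewrite natrX mulKf ?expf_neq0.
Qed.

Lemma measurable_xlogx (R : realType) : measurable_fun [set: R] (@xlogx R).
Proof. by apply: measurable_funM => //; exact: measurable_ln. Qed.

(** By Tonelli, a second factor of mass 1 leaves the second moment unchanged. *)
Lemma Lnorm2_comp_fst d1 d2 (T1 : measurableType d1) (T2 : measurableType d2)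
    (R : realType) (P1 : probability T1 R) (P2 : probability T2 R) (h : T1 -> R)
    (c : R) :
  measurable_fun [set: T1] h -> 0 <= c ->
  ('N[P1]_2%:E [EFin \o h] <= c%:E)%E ->
  ('N[P1 \x P2]_2%:E [EFin \o (h \o fst)] <= c%:E)%E.
Proof.
move=> mh c0; rewrite !Lnorm2_le// => hc.
rewrite fubini_tonelli1; last by move=> p; rewrite lee_fin sqr_ge0.
  apply: le_trans hc; rewrite le_eqVlt; apply/orP; left; apply/eqP.
  by apply: eq_integral => t _; exact: (integral_prob_cst P2 (h t ^+ 2)%:E).
by apply: measurable_sqr; exact: measurableT_comp.
Qed.

(** * Error of the nested rule under independent shifts *)

Section nested_lattice_rule.
Variables (R : realType) (s k : nat) (f : 'rV[R]_s -> 'rV[R]_k -> R).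
Hypothesis f_cont : {within ucube s `*` ucube k,
  continuous (fun p : 'rV[R]_s * 'rV[R]_k => f p.1 p.2)}.

Let gI2 (y : 'rV[R]_k) : R := xlogx (cube_int (f ^~ y)).
Let gQ2 l2 z2 (D2 : s.-tuple R) (y : 'rV[R]_k) : R :=
  xlogx (lattice_rule l2 z2 (row_of D2) (f ^~ y)).

Lemma measurable_outer_rule_integral l1 z1 :
  measurable_fun [set: k.-tuple R]
    (fun D => lattice_rule l1 z1 (row_of D) gI2).
Proof.
apply: measurable_funM => //; apply: measurable_sum => i.
apply: (measurableT_comp (@measurable_xlogx R)).
apply: measurable_cube_int => // [t|j]; first exact: lattice_point_ucube.
by apply: measurable_lattice_point; exact: measurable_row_of.
Qed.

(** Joint measurability in both shifts, for Tonelli and Minkowski on the product space. *)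
Lemma measurable_outer_rule_nested l1 z1 l2 z2 :
  measurable_fun [set: k.-tuple R * s.-tuple R]
    (fun D => lattice_rule l1 z1 (row_of D.1) (gQ2 l2 z2 D.2)).
Proof.
apply: measurable_funM => //; apply: measurable_sum => i.
apply: (measurableT_comp (@measurable_xlogx R)).
apply: measurable_lattice_rule => // [j|t|j].
- by apply: (measurableT_comp (@measurable_row_of R s j)).
- exact: lattice_point_ucube.
- apply: measurable_lattice_point.
  by apply: (measurableT_comp (@measurable_row_of R k j)).
Qed.

Variables (M a K : R).
Hypothesis fM : forall x y, ucube s x -> ucube k y -> `|f x y| <= M.
Hypothesis a01 : 0 < a < 1.
Hypothesis K0 : 0 < K.
Hypothesis xlogxK : forall x y : R, `|x| <= M -> `|y| <= M ->
  `|xlogx x - xlogx y| <= K * `|x - y| `^ a.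

Lemma inner_second_moment l2 z2 e y : 0 < e -> ucube k y ->
  (lattice_rmse l2 z2 (f ^~ y) <= e%:E)%E ->
  (\int[cube_prob R s]_D ((gI2 y - gQ2 l2 z2 D y) ^+ 2)%:E <=
   ((2 * K * e `^ a) ^+ 2)%:E)%E.
Proof.
move=> e0 cy.
have mQ : measurable_fun [set: s.-tuple R]
    (fun D => lattice_rule l2 z2 (row_of D) (f ^~ y)).
  by apply: measurable_lattice_rule => // j; exact: measurable_row_of.
rewrite /lattice_rmse (Lnorm2_le (cube_prob R s)
  (fun D => cube_int (f ^~ y) - lattice_rule l2 z2 (row_of D) (f ^~ y))
  (ltW e0)).
apply: hoelder_second_moment => //; first exact: ltW.
- apply: measurable_funB => //.
  exact: (measurableT_comp (@measurable_xlogx R)).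
- exact: measurable_funB.
(* The integral and the rule both average values of [f], hence lie in [[-M, M]], where the Hoelder
   bound holds. *)
move=> D; apply: xlogxK; first by apply: cube_int_norm_le => // x cx; exact: fM.
by apply: lattice_rule_norm_le => x cx; exact: fM.
Qed.

(** The product measure expresses independence: with the outer shift frozen, the outer rule averages
    over fixed points of the cube, and the inner second moments are bounded uniformly there. A
    constant bound survives integration over the outer shift. *)
Lemma outer_rule_difference_rmse l1 z1 l2 z2 e : 0 < e ->
  (forall y, ucube k y -> (lattice_rmse l2 z2 (f ^~ y) <= e%:E)%E) ->
  ('N[cube_prob R k \x cube_prob R s]_2%:E
     [EFin \o (fun D : k.-tuple R * s.-tuple R =>
        lattice_rule l1 z1 (row_of D.1) gI2 -
        lattice_rule l1 z1 (row_of D.1) (gQ2 l2 z2 D.2))%R] <=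
   (2 * K * e `^ a)%:E)%E.
Proof.
move=> e0 rmse_e.
have c0 : 0 <= 2 * K * e `^ a by rewrite !mulr_ge0 ?powR_ge0 ?(ltW K0).
rewrite Lnorm2_le//.
rewrite fubini_tonelli1; last by move=> p; rewrite lee_fin sqr_ge0.
  rewrite -[leRHS](integral_prob_cst (cube_prob R k)).
  apply: ge0_le_integral => //.
  - by move=> t _; apply: integral_ge0 => x _; rewrite lee_fin sqr_ge0.
  - apply: measurable_fun_fubini_tonelli_F; last first.
      by move=> p; rewrite lee_fin sqr_ge0.
    apply: measurable_sqr; apply: measurable_funB.
      by apply: (measurableT_comp (measurable_outer_rule_integral l1 z1)).
    exact: measurable_outer_rule_nested.
  - move=> D1 _; rewrite /fubini_F/=.
    under eq_integral do rewrite -lattice_ruleB.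
    apply: (@lattice_rule_second_moment _ _ _ (cube_prob R s) _ _ _ _
      (fun y D => gI2 y - gQ2 l2 z2 D y)) => y cy.
      apply: measurable_funB => //; apply: (measurableT_comp (@measurable_xlogx R)).
      by apply: measurable_lattice_rule => // j; exact: measurable_row_of.
    exact: inner_second_moment (rmse_e _ cy).
apply: measurable_sqr; apply: measurable_funB.
  by apply: (measurableT_comp (measurable_outer_rule_integral l1 z1)).
exact: measurable_outer_rule_nested.
Qed.

(** Minkowski's inequality, with [h] depending on the outer shift alone. *)
Lemma nested_rule_rmse l1 z1 l2 z2 (c e : R) : 0 <= c -> 0 < e ->
  (lattice_rmse l1 z1 gI2 <= c%:E)%E ->
  (forall y, ucube k y -> (lattice_rmse l2 z2 (f ^~ y) <= e%:E)%E) ->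
  ('N[cube_prob R k \x cube_prob R s]_2%:E
     [(fun D => (cube_int gI2 -
                 lattice_rule l1 z1 (row_of D.1) (gQ2 l2 z2 D.2))%:E)] <=
   (c + 2 * K * e `^ a)%:E)%E.
Proof.
move=> c0 e0 rmse_c rmse_e.
pose h D := cube_int gI2 - lattice_rule l1 z1 (row_of D) gI2.
pose b (D : k.-tuple R * s.-tuple R) := lattice_rule l1 z1 (row_of D.1) gI2 -
  lattice_rule l1 z1 (row_of D.1) (gQ2 l2 z2 D.2).
have mh : measurable_fun [set: k.-tuple R] h.
  by apply: measurable_funB => //; exact: measurable_outer_rule_integral.
have mb : measurable_fun [set: k.-tuple R * s.-tuple R] b.
  apply: measurable_funB; last exact: measurable_outer_rule_nested.
  by apply: (measurableT_comp (measurable_outer_rule_integral l1 z1)).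
rewrite (_ : (fun D => _) = EFin \o ((h \o fst) \+ b)); last first.
  by apply/funext => D; rewrite /= /h /b addrA subrK.
have mhf : measurable_fun [set: k.-tuple R * s.-tuple R] (h \o fst).
  exact: measurableT_comp.
have le12 : (1 : R) <= 2 by rewrite ler1n.
apply: (le_trans (minkowski_EFin (cube_prob R k \x cube_prob R s)%E mhf mb le12)).
rewrite [leRHS]EFinD leeD//; first exact: Lnorm2_comp_fst.
exact: outer_rule_difference_rmse.
Qed.

End nested_lattice_rule.

(** * From the nested estimate to the convergence rates *)

Theorem theorem7p2 (R : realType) (s k : nat)
  (gamma1 : {set 'I_k} -> R) (gamma2 : {set 'I_s} -> R)
  (gamma1_gt0 : forall u, 0 < gamma1 u)
  (gamma2_gt0 : forall u, 0 < gamma2 u)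
  (z1 : nat -> 'rV[int]_k) (z2 : nat -> 'rV[int]_s)
  (f : 'rV[R]_s -> 'rV[R]_k -> R)
  (f_cont : {within ucube s `*` ucube k,
     continuous (fun p : 'rV[R]_s * 'rV[R]_k => f p.1 p.2)})
  (C : R) (C_gt0 : 0 < C)
  (f_sobolev : forall y, ucube k y -> sobolev (f ^~ y))
  (f_bounded : (ereal_sup
     [set (sobolev_norm gamma2 (f ^~ y))%:E | y in ucube k] <= C%:E)%E)
  (gI2f_sobolev : sobolev (fun y : 'rV[R]_k => xlogx (cube_int (f ^~ y))))
  (gQ2f_sobolev : forall l, {ae cube_prob R s, forall D,
     sobolev (fun y : 'rV[R]_k =>
       xlogx (lattice_rule l (z2 l) (row_of D) (f ^~ y)))})
  (C1 C2 delta1 delta2 : R)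
  (C1_gt0 : 0 < C1) (C2_gt0 : 0 < C2)
  (delta1_gt0 : 0 < delta1) (delta2_gt0 : 0 < delta2)
  (Q1_error : forall l (F : 'rV[R]_k -> R), sobolev F ->
     (lattice_rmse l (z1 l) F <=
      (C1 * 2 `^ (- delta1 * l%:R) * sobolev_norm gamma1 F)%:E)%E)
  (Q2_error : forall l (F : 'rV[R]_s -> R), sobolev F ->
     (lattice_rmse l (z2 l) F <=
      (C2 * 2 `^ (- delta2 * l%:R) * sobolev_norm gamma2 F)%:E)%E) :
  let calI : R := cube_int (fun y : 'rV[R]_k => xlogx (cube_int (f ^~ y))) in
  let rmse (l1 l2 : nat) : \bar R :=
    'N[cube_prob R k \x cube_prob R s]_2%:E
      [(fun D => (calI - lattice_rule l1 (z1 l1) (row_of D.1) (fun y =>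
         xlogx (lattice_rule l2 (z2 l2) (row_of D.2) (f ^~ y))))%:E)]%E in
  forall alpha : R, 0 < alpha < 1 ->
  (exists2 C2' : R, 0 < C2' & forall l1 l2 : nat,
     (rmse l1 l2 <=
      (C1 * 2 `^ (- delta1 * l1%:R) *
         sobolev_norm gamma1 (fun y => xlogx (cube_int (f ^~ y))))%:E +
      (C2' * 2 `^ (- (alpha * delta2) * l2%:R))%:E *
         ereal_sup [set (sobolev_norm gamma2 (f ^~ y))%:E | y in ucube k])%E)
  /\
  (exists2 C' : R, 0 < C' & forall l : nat,
     (rmse l l <=
      (C' * 2 `^ (- (Num.min delta1 (alpha * delta2) / 2) * l%:R))%:E)%E).
Proof.
move=> calI rmse alpha a01; have /andP[a0 a1] := a01.
have [M M0 fM] := continuous_ucube_bounded f_cont.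
have [K K0 gK] := xlogx_hoelder a01 M0.
set N := sobolev_norm gamma1 _; have N0 : 0 <= N by exact: sqrtr_ge0.
set normsup := ereal_sup _; pose S := fine normsup.
(* A point of the cube keeps the supremum away from [-oo]; with [f_bounded] it is then a real number
   [S]. *)
have cube0 : ucube k (0 : 'rV[R]_k) by move=> j; rewrite mxE lexx ler01.
have norm_le y : ucube k y ->
    ((sobolev_norm gamma2 (f ^~ y))%:E <= normsup)%E.
  by move=> cy; apply: ereal_sup_ubound; exists y.
have SE : normsup = S%:E.
  rewrite /S fineK// ge0_fin_numE; first by rewrite (le_lt_trans f_bounded) ?ltry.
  by rewrite (le_trans _ (norm_le _ cube0))// lee_fin sqrtr_ge0.
have S0 : 0 <= S.
  by rewrite -lee_fin -SE (le_trans _ (norm_le _ cube0))// lee_fin sqrtr_ge0.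
pose c l : R := C1 * 2 `^ (- delta1 * l%:R) * N.
have c0 l : 0 <= c l by rewrite !mulr_ge0 ?powR_ge0 ?(ltW C1_gt0).
(* [e] stays free: it must be positive, whereas the natural choice [C2 * 2 ^ (- delta2 * l2) * S] is
   0 when [S = 0]. *)
have rmse_le l1 l2 e : 0 < e -> C2 * 2 `^ (- delta2 * l2%:R) * S <= e ->
    (rmse l1 l2 <= (c l1 + 2 * K * e `^ alpha)%:E)%E.
  move=> e0 Se; apply: (nested_rule_rmse f_cont fM a01 K0 gK) => //.
    exact: Q1_error.
  move=> y cy; apply: (le_trans (Q2_error l2 _ (f_sobolev y cy))).
  rewrite lee_fin (le_trans _ Se)// ler_wpM2l ?mulr_ge0 ?powR_ge0 ?(ltW C2_gt0)//.
  by rewrite -lee_fin -SE norm_le.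
have [C2' C2'0 rmse_C2'] : exists2 C2' : R, 0 < C2' & forall l1 l2,
    (rmse l1 l2 <= (c l1 + C2' * 2 `^ (- (alpha * delta2) * l2%:R) * S)%:E)%E.
  have [S_eq0|S_neq0] := eqVneq S 0.
    (* [rmse_le] then holds for all [e > 0], and the second term vanishes. *)
    exists 1 => // l1 l2; rewrite S_eq0 mulr0 addr0; apply/lee_addgt0Pr => e e0.
    (* Solves [2 * K * e' ^ alpha = e]. *)
    pose e' := (e / (2 * K)) `^ alpha^-1.
    have K20 : 0 < 2 * K by rewrite mulr_gt0.
    have e'0 : 0 < e' by rewrite powR_gt0 ?divr_gt0.
    have := @rmse_le l1 l2 e' e'0; rewrite S_eq0 mulr0 => /(_ (ltW e'0)).
    rewrite /e' -powRrM mulVf ?gt_eqF// powRr1 ?divr_ge0 ?(ltW e0) ?(ltW K20)//.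
    by rewrite mulrC divfK ?gt_eqF// EFinD.
  have {}S0 : 0 < S by rewrite lt_neqAle eq_sym S_neq0.
  (* The estimate yields [S ^ alpha] but the claim is linear in [S]; the ratio [S ^ alpha / S] goes
     into the constant. *)
  exists (2 * K * (C2 `^ alpha * (S `^ alpha / S))) => [|l1 l2].
    by rewrite !mulr_gt0 ?invr_gt0 ?powR_gt0.
  have q0 : 0 < 2 `^ (- delta2 * l2%:R) :> R by exact: powR_gt0.
  apply: (le_trans (rmse_le l1 l2 (C2 * 2 `^ (- delta2 * l2%:R) * S) _ _)) => //.
    by rewrite !mulr_gt0.
  rewrite !powRM ?mulr_ge0 ?(ltW q0) ?(ltW C2_gt0) ?(ltW S0)// -powRrM.
  have -> : - delta2 * l2%:R * alpha = - (alpha * delta2) * l2%:R by ring.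
  by rewrite lee_fin lerD2l le_eqVlt; apply/orP; left; apply/eqP; field.
split.
  by exists C2' => // l1 l2; rewrite SE -EFinM -EFinD.
(* The summand 1 keeps the constant positive even if [N] and [S] vanish. *)
exists (C1 * N + C2' * S + 1) => [|l].
  by rewrite ltr_wpDl// addr_ge0 ?mulr_ge0 ?(ltW C1_gt0) ?(ltW C2'0).
apply: (le_trans (rmse_C2' l l)); rewrite lee_fin.
set q := 2 `^ (- (_ / 2) * _).
(* Half of the minimum leaves slack: it is at most [d], since the minimum is at most [d] and
   [d <= 2 * d]. *)
have q_le d : 0 < d -> Num.min delta1 (alpha * delta2) <= d ->
    2 `^ (- d * l%:R) <= q.
  move=> d0 md; apply: ler_powR; rewrite ?ler1n// ler_wpM2r// lerN2.
  by rewrite ler_pdivrMr// (le_trans md)// ler_peMr ?ler1n// ltW.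
have q1 : 2 `^ (- delta1 * l%:R) <= q by rewrite q_le// ge_min lexx.
have q2 : 2 `^ (- (alpha * delta2) * l%:R) <= q.
  by rewrite q_le ?mulr_gt0// ge_min lexx orbT.
have q0 : 0 <= q by exact: powR_ge0.
rewrite !mulrDl mul1r ler_wpDr// lerD//.
  by rewrite /c mulrAC ler_wpM2l// mulr_ge0// ltW.
by rewrite mulrAC ler_wpM2l// mulr_ge0// ltW.
Qed.
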